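(* Let $Y$ be a nonnegative random variable with finite positive mean $\mu$, and suppose that, for some $c>0$, there is a random variable $Y^s$ defined on the same probability space as $Y$, having the $Y$-size bias distribution, and satisfying $Y^s\le Y+c$ almost surely. Then $$P(Y-\mu\le -t)\le\exp\left(-\frac{t^2}{2c\mu}\right)\qquad\text{for all } t>0.$$
   Context: For a nonnegative random variable $Y$ with finite positive mean $\mu$, a random variable $Y^s$ has the $Y$-size bias distribution if $E[Yf(Y)]=\mu E[f(Y^s)]$ for all functions $f$ for which these expectations exist. *)

(* Defs.v *)
From HB Require Import structures.
From mathcomp Require Import all_boot all_order all_algebra.
From mathcomp Require Import all_classical all_reals all_analysis.

Set Implicit Arguments.
Unset Strict Implicit.
Unset Printing Implicit Defensive.

Import Order.TTheory GRing.Theory Num.Theory.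

Local Open Scope classical_set_scope.
Local Open Scope ereal_scope.
Local Open Scope ring_scope.

(* [Ys] has the [Y]-size bias distribution.  "The expectations exist" is read
   as: [f] is Borel and both [Y f(Y)] and [f(Ys)] are integrable.
   This is a condition on the law of [Ys] only, so [Ys] may live on a different
   probability space.  Only meaningful when [Y] is nonnegative with finite
   positive mean; these are left as hypotheses of the theorems using it. *)
Definition size_bias {R : realType}
    {d : measure_display} {T : measurableType d} (P : probability T R)
    {d' : measure_display} {T' : measurableType d'} (P' : probability T' R)
    (Y : {RV P >-> R}) (Ys : {RV P' >-> R}) : Prop :=
  forall f : R -> R, measurable_fun [set: R] f ->
    P.-integrable [set: T] (fun w => (Y w * f (Y w))%:E) ->
    P'.-integrable [set: T'] (fun w => (f (Ys w))%:E) ->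
    'E_P[fun w => Y w * f (Y w)] = ('E_P[Y] * 'E_P'[fun w => f (Ys w)])%E.

(* Main.v *)
Require Import Defs.
From HB Require Import structures.
From mathcomp Require Import all_boot all_order all_algebra.
From mathcomp Require Import all_classical all_reals all_analysis.
From mathcomp Require Import measurable_realfun ring lra.

Set Implicit Arguments.
Unset Strict Implicit.
Unset Printing Implicit Defensive.

Import Order.TTheory GRing.Theory Num.Theory.

Local Open Scope classical_set_scope.
Local Open Scope ereal_scope.
Local Open Scope ring_scope.

(** Let [m s = E[exp(- s Y)]] for [s >= 0].  Testing the size bias identity
    against [exp(- s y)] and using [Ys <= Y + c] gives
    [- m' s = mu E[exp(- s Ys)] >= mu exp(- s c) m s], hence
    [m s <= exp(- mu s + mu c s^2 / 2)], and the Chernoff bound at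
    [s = t / (c mu)] gives the claim.  Differentiation under the expectation is
    avoided by working with increments:
    [exp(- s y) >= (1 + h y) exp(- (s + h) y)] turns the differential inequality
    into [(1 + h mu exp(- (s + h) c)) m (s + h) <= m s]. *)

(** Limit passage that removes the [O(1/n)] error of the Euler scheme. If [expR A < p], then
    [ln p - A] is positive, and it exceeds [B / n.+1%:R] once [n] is large, a contradiction. *)
Lemma le_expR_of_inv_nat (R : realType) (p A B : R) :
  (forall n : nat, p <= expR (A + B / n.+1%:R)) -> p <= expR A.
Proof.
move=> H; case: (leP p 0) => [p0|p0]; first exact: le_trans (expR_ge0 _).
rewrite -[p]lnK ?posrE// ler_expR leNgt; apply/negP => Ap.
have [n Bn] : exists n : nat, B / (ln p - A) < n%:R.
  exists (Num.truncn `|B / (ln p - A)|).+1.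
  exact: le_lt_trans (ler_norm _) (truncnS_gt _).
have := H n; rewrite -{1}[p]lnK ?posrE// ler_expR leNgt => /negP; apply.
rewrite -ltrBrDl ltr_pdivrMr ?ltr0n// mulrC -ltr_pdivrMr ?subr_gt0//.
by apply: lt_trans Bn _; rewrite ltr_nat.
Qed.

(** By [1 + y <= expR y] it suffices that [1 <= (1 + x) * (1 - x + x ^+ 2)], and the product equals
    [1 + x ^+ 3]. *)
Lemma inv1D_le_expR (R : realType) (x : R) :
  0 <= x -> (1 + x)^-1 <= expR (- x + x ^+ 2).
Proof.
move=> x0; apply: le_trans (expR_ge1Dx _).
have x1 : 0 < 1 + x by lra.
rewrite -div1r ler_pdivrMr//; nra.
Qed.

(* Euler scheme for [m' <= - mu exp(-c s) m] : since [exp(-c s) >= 1 - c s], the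
   product of the [n] factors is at most
   [exp(- mu s + mu c s^2 / 2)] up to a factor [exp(O(1/n))]. *)
Lemma discrete_gronwall (R : realType) (mu c : R) (m : R -> R) :
  0 <= mu -> 0 <= c -> m 0 <= 1 ->
  (forall s h, 0 <= s -> 0 <= h ->
    (1 + h * mu * expR (- ((s + h) * c))) * m (s + h) <= m s) ->
  forall s, 0 <= s -> m s <= expR (- (mu * s) + mu * c * s ^+ 2 / 2).
Proof.
move=> mu0 c0 m01 mS s s0.
(* [K * h ^+ 2] is the error of one step of length [h]: [mu * c / 2] comes from evaluating
   [mu * c * s] at the right endpoint instead of integrating it, [mu ^+ 2] from the quadratic term
   of [inv1D_le_expR]. *)
pose K := mu * c / 2 + mu ^+ 2.
have Hk h (k : nat) : 0 <= h -> m (k%:R * h) <=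
    expR (- (mu * (k%:R * h)) + mu * c * (k%:R * h) ^+ 2 / 2 +
          K * h * (k%:R * h)).
  move=> h0; elim: k => [|k IH].
    by rewrite !mul0r !(expr0n, mulr0, mul0r) oppr0 !addr0 expR0.
  set a := k%:R * h in IH *.
  have a0 : 0 <= a by rewrite mulr_ge0.
  have -> : k.+1%:R * h = a + h by rewrite -natr1 mulrDl mul1r.
  set x := h * mu * expR (- ((a + h) * c)).
  have x0 : 0 <= x by rewrite !mulr_ge0 ?expR_ge0.
  have x1 : 0 < 1 + x by lra.
  have xle : x <= h * mu.
    rewrite ler_piMr ?mulr_ge0// -[leRHS]expR0 ler_expR oppr_le0.
    by rewrite mulr_ge0 ?addr_ge0.
  have xge : h * mu * (1 - (a + h) * c) <= x.
    by apply: ler_wpM2l; [rewrite mulr_ge0|rewrite expR_ge1Dx].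
  have : m (a + h) <= (1 + x)^-1 * m a by rewrite ler_pdivlMl// mS.
  move=> /le_trans; apply.
  apply: le_trans (ler_wpM2l _ IH) _; first by rewrite invr_ge0 ltW.
  apply: le_trans (ler_wpM2r (expR_ge0 _) (inv1D_le_expR x0)) _.
  rewrite -expRD ler_expR.
  have x2 : x ^+ 2 <= (h * mu) ^+ 2 by rewrite lerXn2r ?nnegrE ?mulr_ge0.
  rewrite /K; lra.
(* [n.+1] steps of length [s / n.+1%:R] reach [s] with total error [K * s ^+ 2 / n.+1%:R]. *)
apply: (@le_expR_of_inv_nat _ _ _ (K * s ^+ 2)) => n.
have n0 : n.+1%:R != 0 :> R by rewrite pnatr_eq0.
have := Hk (s / n.+1%:R) n.+1.
rewrite divr_ge0// => /(_ isT).
have -> : n.+1%:R * (s / n.+1%:R) = s by field.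
move=> /le_trans; apply; rewrite ler_expR lerD2l.
by rewrite le_eqVlt; apply/orP; left; apply/eqP; field.
Qed.

(* Truncating at [0] makes this a bounded test function on all of [R], so that
   [size_bias] applies without knowing beforehand that [Ys >= 0] a.s. *)
Definition exp_pos_part (R : realType) (s y : R) : R :=
  expR (- (s * Num.max y 0)).

Section exp_pos_part.
Context (R : realType).
Implicit Types (s h y : R).

Lemma exp_pos_part_ge0 s y : 0 <= exp_pos_part s y.
Proof. exact: expR_ge0. Qed.

Lemma exp_pos_part_le1 s y : 0 <= s -> exp_pos_part s y <= 1.
Proof.
move=> s0; rewrite -[leRHS]expR0 ler_expR oppr_le0 mulr_ge0//.
by rewrite le_max lexx orbT.
Qed.

Lemma measurable_exp_pos_part s : measurable_fun [set: R] (exp_pos_part s).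
Proof.
apply: measurableT_comp => //; apply: measurableT_comp => //.
by apply: measurable_funM => //; exact: measurable_maxr.
Qed.

Lemma exp_pos_part_step s h y : 0 <= h ->
  exp_pos_part (s + h) y + h * (Num.max y 0 * exp_pos_part (s + h) y)
  <= exp_pos_part s y.
Proof.
move=> h0; rewrite /exp_pos_part.
set z := Num.max y 0.
have -> : expR (- (s * z)) = expR (h * z) * expR (- ((s + h) * z)).
  by rewrite -expRD; congr expR; ring.
by rewrite mulrA -{1}[expR _]mul1r -mulrDl ler_wpM2r ?expR_ge0// expR_ge1Dx.
Qed.

(** The bound survives truncation: [max y' 0 <= max y 0 + c], where [0 <= c] covers the case of
    negative [y']. *)
Lemma exp_pos_part_shift s c y y' : 0 <= s -> 0 <= c -> y' <= y + c ->
  expR (- (s * c)) * exp_pos_part s y <= exp_pos_part s y'.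
Proof.
move=> s0 c0 yc; rewrite /exp_pos_part -expRD ler_expR -opprD lerN2 -mulrDr.
rewrite ler_wpM2l// ge_max addrC; apply/andP; split.
- by apply: le_trans yc _; rewrite lerD2r le_max lexx.
- by rewrite addr_ge0// le_max lexx orbT.
Qed.

End exp_pos_part.

Section laplace_transform.
Context (R : realType) (d : measure_display) (T : measurableType d).
Context (P : probability T R).

Lemma expectation_ae_eq (X Y : T -> R) :
  measurable_fun [set: T] X -> measurable_fun [set: T] Y ->
  {ae P, forall w, X w = Y w} -> 'E_P[X] = 'E_P[Y].
Proof.
move=> mX mY XY; rewrite unlock; apply: ae_eq_integral => //.
- exact/measurable_EFinP.
- exact/measurable_EFinP.
- by apply: filterS XY => w /= -> _.
Qed.

Lemma ge0_expectationZl (k : R) (X : T -> R) : 0 <= k ->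
  measurable_fun [set: T] X -> (forall w, 0 <= X w) ->
  'E_P[fun w => k * X w] = (k%:E * 'E_P[X])%E.
Proof.
move=> k0 mX X0; rewrite unlock -ge0_integralZl_EFin//.
- by move=> w _; rewrite lee_fin.
- exact/measurable_EFinP.
Qed.

Lemma ge0_expectationD (X Y : T -> R) :
  measurable_fun [set: T] X -> (forall w, 0 <= X w) ->
  measurable_fun [set: T] Y -> (forall w, 0 <= Y w) ->
  'E_P[fun w => X w + Y w] = ('E_P[X] + 'E_P[Y])%E.
Proof.
move=> mX X0 mY Y0; rewrite unlock -ge0_integralD//.
- by move=> w _; rewrite lee_fin.
- exact/measurable_EFinP.
- by move=> w _; rewrite lee_fin.
- exact/measurable_EFinP.
Qed.

Lemma ae_ge0_integrable (Y : {RV P >-> R}) :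
  {ae P, forall w, 0 <= Y w} -> ('E_P[Y] < +oo)%E ->
  P.-integrable [set: T] (EFin \o Y).
Proof.
move=> Y0 EY; apply/integrableP; split; first exact/measurable_EFinP.
apply: le_lt_trans EY; rewrite unlock le_eqVlt; apply/orP; left; apply/eqP.
apply: ae_eq_integral => //.
- by apply: measurableT_comp => //; exact/measurable_EFinP.
- exact/measurable_EFinP.
- by apply: filterS Y0 => w /= Yw _; rewrite ger0_norm.
Qed.

Lemma expectation_exp_pos_part_le1 (Y : {RV P >-> R}) (s : R) : 0 <= s ->
  ('E_P[fun w => exp_pos_part s (Y w)] <= 1)%E.
Proof.
move=> s0; rewrite -[leRHS](expectation_cst P 1); apply: expectation_le => //.
- by apply: measurableT_comp => //; exact: measurable_exp_pos_part.
- by move=> w; exact: exp_pos_part_ge0.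
- by apply: aeW => w; exact: exp_pos_part_le1.
Qed.

Lemma size_bias_laplace_step (Y Ys : {RV P >-> R}) (mu c s h : R) :
  {ae P, forall w, 0 <= Y w} -> 'E_P[Y] = mu%:E -> 0 <= mu -> 0 <= c ->
  size_bias Y Ys -> {ae P, forall w, Ys w <= Y w + c} -> 0 <= s -> 0 <= h ->
  ((1 + h * mu * expR (- ((s + h) * c)))%:E *
     'E_P[fun w => exp_pos_part (s + h) (Y w)] <=
   'E_P[fun w => exp_pos_part s (Y w)])%E.
Proof.
move=> Y0 EY mu0 c0 bias YsY s0 h0; set r := s + h.
have r0 : 0 <= r by rewrite addr_ge0.
have mg (X : {RV P >-> R}) q :
    measurable_fun [set: T] (fun w => exp_pos_part q (X w)).
  by apply: measurableT_comp => //; exact: measurable_exp_pos_part.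
(* [Y] is nonnegative only almost surely; its positive part is so everywhere, as [ge0_expectationZl]
   and [ge0_expectationD] require. *)
have mZ : measurable_fun [set: T] (fun w => Num.max (Y w) 0).
  exact: measurable_maxr.
have mZg : measurable_fun [set: T]
    (fun w => Num.max (Y w) 0 * exp_pos_part r (Y w)).
  exact: measurable_funM.
have Zg0 w : 0 <= Num.max (Y w) 0 * exp_pos_part r (Y w).
  by rewrite mulr_ge0 ?exp_pos_part_ge0// le_max lexx orbT.
have mYg : measurable_fun [set: T] (fun w => Y w * exp_pos_part r (Y w)).
  exact: measurable_funM.
have iY : P.-integrable [set: T] (EFin \o Y).
  by apply: ae_ge0_integrable => //; rewrite EY ltry.
(* Size bias identity for the test function [exp_pos_part r]. With values in [[0, 1]], it gives
   integrands dominated by [Y] and by the constant [1]. *)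
have EZg : 'E_P[fun w => Num.max (Y w) 0 * exp_pos_part r (Y w)] =
    (mu%:E * 'E_P[fun w => exp_pos_part r (Ys w)])%E.
  rewrite -EY -bias.
  - apply: expectation_ae_eq => //.
    by apply: filterS Y0 => w Yw; rewrite max_l.
  - exact: measurable_exp_pos_part.
  - apply: le_integrable iY => //; first exact/measurable_EFinP.
    move=> w _ /=; rewrite lee_fin normrM ler_piMr//.
    by rewrite ger0_norm ?exp_pos_part_ge0 ?exp_pos_part_le1.
  - apply: le_integrable (finite_measure_integrable_cst P 1 measurableT) => //.
      exact/measurable_EFinP.
    move=> w _ /=; rewrite lee_fin normr1.
    by rewrite ger0_norm ?exp_pos_part_ge0 ?exp_pos_part_le1.
have shift : ((expR (- (r * c)))%:E * 'E_P[fun w => exp_pos_part r (Y w)] <=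
    'E_P[fun w => exp_pos_part r (Ys w)])%E.
  rewrite -ge0_expectationZl ?expR_ge0//; last first.
    by move=> w; exact: exp_pos_part_ge0.
  apply: expectation_le => //.
  - exact: measurable_funM.
  - by move=> w; rewrite mulr_ge0 ?expR_ge0 ?exp_pos_part_ge0.
  - by move=> w; exact: exp_pos_part_ge0.
  - by apply: filterS YsY => w; exact: exp_pos_part_shift.
have E0 : (0 <= 'E_P[fun w => exp_pos_part r (Y w)])%E.
  by apply: expectation_ge0 => w; exact: exp_pos_part_ge0.
have : ((1 + h * mu * expR (- (r * c)))%:E *
      'E_P[fun w => exp_pos_part r (Y w)]
    <= 'E_P[fun w => exp_pos_part r (Y w)] +
       h%:E * 'E_P[fun w => (Num.max (Y w) 0 * exp_pos_part r (Y w))%R])%E.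
  rewrite EFinD ge0_muleDl ?lee_fin ?mulr_ge0 ?expR_ge0// mul1e leeD2l//.
  by rewrite EZg !EFinM -!muleA lee_wpmul2l ?lee_fin// lee_wpmul2l ?lee_fin.
(* By linearity the bound becomes the expectation of the left side of [exp_pos_part_step], which is
   then used pointwise. *)
move/le_trans; apply; rewrite -ge0_expectationZl// -ge0_expectationD//.
- apply: expectation_le => //.
  + by apply: measurable_funD => //; apply: measurable_funM.
  + by move=> w; apply: addr_ge0; [exact: exp_pos_part_ge0|apply: mulr_ge0].
  + by move=> w; exact: exp_pos_part_ge0.
  + by apply: aeW => w; exact: exp_pos_part_step.
- by move=> w; exact: exp_pos_part_ge0.
- exact: measurable_funM.
- by move=> w; apply: mulr_ge0.
Qed.

Lemma size_bias_laplace (Y Ys : {RV P >-> R}) (mu c s : R) :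
  {ae P, forall w, 0 <= Y w} -> 'E_P[Y] = mu%:E -> 0 <= mu -> 0 <= c ->
  size_bias Y Ys -> {ae P, forall w, Ys w <= Y w + c} -> 0 <= s ->
  ('E_P[fun w => exp_pos_part s (Y w)] <=
   (expR (- (mu * s) + mu * c * s ^+ 2 / 2))%:E)%E.
Proof.
move=> Y0 EY mu0 c0 bias YsY s0.
(* Finiteness lets the extended-real inequalities be read in [R], where [discrete_gronwall]
   applies. *)
have fin q : 0 <= q -> 'E_P[fun w => exp_pos_part q (Y w)] \is a fin_num.
  move=> q0; rewrite ge0_fin_numE.
    by apply: le_lt_trans (expectation_exp_pos_part_le1 Y q0) _; rewrite ltry.
  by apply: expectation_ge0 => w; exact: exp_pos_part_ge0.
rewrite -[leLHS]fineK ?fin// lee_fin.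
apply: (@discrete_gronwall _ mu c
  (fun q => fine 'E_P[fun w => exp_pos_part q (Y w)])) => //.
- by rewrite -lee_fin fineK ?fin//; exact: expectation_exp_pos_part_le1.
- move=> q h q0 h0; rewrite -lee_fin EFinM !fineK ?fin ?addr_ge0//.
  exact: size_bias_laplace_step bias YsY q0 h0.
Qed.

End laplace_transform.

Theorem mainTheorem6 (R : realType) (d : measure_display) (T : measurableType d)
    (P : probability T R) (Y Ys : {RV P >-> R}) (mu c : R)
    (Y_ge0 : {ae P, forall w, 0 <= Y w})
    (EY : 'E_P[Y] = mu%:E) (mu_gt0 : 0 < mu) (c_gt0 : 0 < c)
    (Ys_bias : size_bias Y Ys)
    (Ys_le : {ae P, forall w, Ys w <= Y w + c}) :
  forall t : R, 0 < t ->
    (P [set w | (Y w - mu <= - t)%R] <=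
       (expR (- (t ^+ 2 / (2 * c * mu))))%:E)%E.
Proof.
move=> t t0.
(* Minimiser of the Chernoff exponent [- (s * t) + mu * c * s ^+ 2 / 2], with minimum
   [- (t ^+ 2 / (2 * c * mu))]. *)
pose s := t / (c * mu).
have s0 : 0 < s by rewrite divr_gt0 ?mulr_gt0.
(* Negation turns the lower tail of [Y] into the upper tail that [chernoff] bounds. *)
have [X XE] : exists X : {RV P >-> R}, forall w, X w = - Y w by exists (- Y).
have -> : [set w | Y w - mu <= - t] = [set w | t - mu <= X w].
  by apply/seteqP; split=> w /=; rewrite XE; lra.
apply: le_trans (chernoff X _ s0) _.
have mgf : ('M_P X s <= (expR (- (mu * s) + mu * c * s ^+ 2 / 2))%:E)%E.
  apply: le_trans (size_bias_laplace Y_ge0 EY (ltW mu_gt0) (ltW c_gt0)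
    Ys_bias Ys_le (ltW s0)).
  rewrite /mmt_gen_fun; apply: expectation_le => //.
  - by apply: measurableT_comp => //; exact: measurable_exp_pos_part.
  - by move=> w; exact: expR_ge0.
  - by move=> w; exact: exp_pos_part_ge0.
  - apply: filterS Y_ge0 => w Yw.
    by rewrite /exp_pos_part max_l// ler_expR /= XE mulNr mulrC.
apply: le_trans (lee_wpmul2r _ mgf) _; first by rewrite lee_fin expR_ge0.
rewrite -EFinM lee_fin -expRD ler_expR le_eqVlt; apply/orP; left; apply/eqP.
by rewrite /s; field; rewrite !gt_eqF.
Qed.
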